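(* Let $H$ be a diagonal hypergraph, uniform of rank $k$, on the vertex set $\{1,\dots,n\}$, with $k>\lceil \frac{n}{2}\rceil$. For $n-k-1\ge r\ge 0$, $$\dim HC_r(\Delta(H))=(n-k)\binom{n-k-1}{r}+\binom{n-k}{r+1},$$ and $$\dim HC_{-1}(\Delta(H))=1.$$
   Context: All vector spaces are over a fixed field of characteristic zero. A hypergraph $H=(V,E)$ consists of a vertex set $V=\{1,\dots,n\}$ and a set $E$ of subsets of $V$ (hyperedges). It is uniform of rank $k$ if all its hyperedges have size $k$. A diagonal hypergraph is a uniform hypergraph of rank $k$ with $n-k+1$ hyperedges that is isomorphic to the hypergraph on $\{1,\dots,n\}$ with edge set $\{\{1,2,\dots,k\},\{2,3,\dots,k+1\},\{3,4,\dots,k+2\},\dots,\{n-k+1,n-k+2,\dots,n\}\}$. For $r\ge -1$ consider ordered set partitions $(B_1,\dots,B_{r+2})$ of $\{1,\dots,n\}$ into nonempty blocks, at least one of which contains a hyperedge of $H$, modulo the signed cyclic relation $(B_1,\dots,B_{r+2})\sim(-1)^{r+1}(B_{\sigma(1)},\dots,B_{\sigma(r+2)})$, where $\sigma=(1,2,\dots,r+2)$ is the cyclic permutation. The class is written $[B_1,\dots,B_{r+2}]$ and is represented by the unique representative with $1\in B_1$. Let $C_r$ be the vector space with basis these classes $[B_1,\dots,B_{r+2}]$ with $1\in B_1$, and let $$\partial_r([B_1,\dots,B_{r+2}])=\sum_{i=1}^{r+1}(-1)^{i+1}[B_1,\dots,B_i\cup B_{i+1},\dots,B_{r+2}]+(-1)^{r+3}[B_1\cup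 B_{r+2},B_2,\dots,B_{r+1}]$$ for $r\ge 0$, and $\partial_{-1}=0$. The cyclic coloring complex $\Delta(H)$ is the chain complex $(C_r,\partial_r)$, and $HC_r(\Delta(H))=\ker\partial_r/\operatorname{im}\partial_{r+1}$. *)

(* Defs.v *)
From HB Require Import structures.
From mathcomp Require Import all_boot all_order all_algebra all_fingroup.
From mathcomp Require Import zify.

Set Implicit Arguments.
Unset Strict Implicit.
Unset Printing Implicit Defensive.

Import GRing.Theory.
Local Open Scope ring_scope.

(* A hypergraph on {1,...,n} is its edge set H : {set {set 'I_n}}; vertex v of
   the mathematics is the ordinal v-1.  Block indices are shifted likewise. *)

Section Hypergraph.
Variable n : nat.
Implicit Types (H G : {set {set 'I_n}}) (k : nat).

Definition uniform H k := [forall e in H, #|e| == k].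

Definition isomorphic H G :=
  [exists s : {perm 'I_n}, G == [set s @: (e : {set 'I_n}) | e : {set 'I_n} in H]].

Definition standard_diagonal k : {set {set 'I_n}} :=
  [set [set v : 'I_n | (i <= v < i + k)%N] | i : 'I_(n - k).+1].

(* k <= n makes n - k + 1 the true (not truncated) number of edges. *)
Definition diagonal H k :=
  [&& (k <= n)%N, uniform H k, #|H| == (n - k + 1)%N
    & isomorphic (standard_diagonal k) H].

End Hypergraph.

Section Cells.
Variables (n : nat) (H : {set {set 'I_n}}).

(* (B_1, ..., B_(m+1)) represents its signed cyclic class; since the blocks are
   nonempty and disjoint, each class has exactly one representative whose first
   block contains the vertex 1, i.e. the ordinal of value 0. *)
Definition is_cell m (B : {ffun 'I_m.+1 -> {set 'I_n}}) : bool :=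
  [&& [forall i, B i != set0],
      [forall i, forall j, (i != j) ==> [disjoint B i & B j]],
      \bigcup_i B i == [set: 'I_n],
      [exists i, [exists e in H, e \subset B i]]
    & [exists v in B ord0, val v == 0%N]].

Definition cell m := {B : {ffun 'I_m.+1 -> {set 'I_n}} | is_cell B}.

Definition merge m (B : {ffun 'I_m.+2 -> {set 'I_n}}) (i : 'I_m.+1) :
    {ffun 'I_m.+1 -> {set 'I_n}} :=
  [ffun j : 'I_m.+1 =>
     if (j < i)%N then B (inord j)
     else if j == i then B (inord i) :|: B (inord i.+1)
     else B (inord j.+1)].

Definition wrap m (B : {ffun 'I_m.+2 -> {set 'I_n}}) :
    {ffun 'I_m.+1 -> {set 'I_n}} :=
  [ffun j : 'I_m.+1 =>
     if j == ord0 then B ord0 :|: B ord_max else B (inord j)].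

Lemma is_cell_coarsen m (B : {ffun 'I_m.+2 -> {set 'I_n}})
    (p : 'I_m.+2 -> 'I_m.+1) (C : {ffun 'I_m.+1 -> {set 'I_n}}) :
  is_cell B -> p ord0 = ord0 -> (forall j, exists l, p l = j) ->
  (forall v j, v \in C j <-> exists2 l, v \in B l & p l = j) ->
  is_cell C.
Proof.
case/and5P=> /forallP B0 /forallP Bdis /eqP Bcov /existsP[a /existsP[e /andP[eH eB]]].
case/existsP=> v0 /andP[v0B v00] p0 psurj CP.
apply/and5P; split.
- apply/forallP=> j; have [l pl] := psurj j.
  have /set0Pn[v vB] := B0 l.
  by apply/set0Pn; exists v; apply/CP; exists l.
- apply/forallP=> i; apply/forallP=> j; apply/implyP=> ij.
  apply/pred0P=> v /=; apply/negP=> /andP[/CP[l vl pl] /CP[l' vl' pl']].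
  have ll' : l != l' by apply: contraNneq ij => ll'; rewrite -pl -pl' ll'.
  have /forallP/(_ l')/implyP/(_ ll')/pred0P/(_ v)/= := Bdis l.
  by rewrite vl vl'.
- apply/eqP/setP=> v; rewrite inE; apply/bigcupP.
  have : v \in \bigcup_i B i by rewrite Bcov inE.
  by case/bigcupP=> l _ vl; exists (p l) => //; apply/CP; exists l.
- apply/existsP; exists (p a); apply/existsP; exists e; rewrite eH /=.
  by apply/subsetP=> v /(subsetP eB) vB; apply/CP; exists a.
- by apply/existsP; exists v0; rewrite v00 andbT; apply/CP; exists ord0.
Qed.

Lemma in_merge m (B : {ffun 'I_m.+2 -> {set 'I_n}}) (i j : 'I_m.+1) v :
  v \in merge B i j <-> exists2 l, v \in B l & unbump i l = j.
Proof.
have inE1 (a : nat) : (a < m.+2)%N -> (@inord m.+1 a) = a :> nat by move/inordK.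
have jm := ltn_ord j; have im := ltn_ord i; rewrite ffunE; split.
  case: ltnP => [ji vB|ij].
    by exists (inord j) => //; rewrite inE1 /unbump; lia.
  case: eqP => [-> | /eqP/negPf ji vB].
    by case/setUP=> vB; [exists (inord i) | exists (inord i.+1)];
      rewrite // inE1 /unbump; lia.
  exists (inord j.+1) => //; rewrite inE1; last lia.
  by move: ji; rewrite -val_eqE /= /unbump; lia.
case=> l vl; have lm := ltn_ord l; rewrite /unbump => jE.
have lE (a : nat) : a = l -> inord a = l by move->; rewrite inord_val.
case: ltnP => [ji|ij]; first by rewrite lE //; lia.
case: eqP => [ji | /eqP/negPf ji].
  apply/setUP; move: jE; rewrite ji; case: (ltnP i l) => il /= jE.
    by right; rewrite lE //; lia.
  by left; rewrite lE //; lia.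
by rewrite lE //; move: ji; rewrite -val_eqE /=; lia.
Qed.

Lemma in_wrap m (B : {ffun 'I_m.+2 -> {set 'I_n}}) (j : 'I_m.+1) v :
  v \in wrap B j <->
  exists2 l : 'I_m.+2, v \in B l & (if l == m.+1 :> nat then 0%N else l) = j.
Proof.
have jm := ltn_ord j; rewrite ffunE; split.
  case: eqP => [-> /setUP[vB|vB] | _ vB].
  - by exists ord0.
  - by exists ord_max => //=; rewrite eqxx.
  by exists (inord j) => //; rewrite inordK; last lia; case: eqP; lia.
case=> l vl lj; have lm := ltn_ord l; case: eqP => j0; last first.
  have j0' : (j : nat) <> 0%N by move=> j1; apply: j0; apply: val_inj.
  by rewrite (_ : (j : nat) = l) ?inord_val //; move: lj; case: eqP; lia.
move: lj; rewrite j0 inE; case: eqP => [lmax _ | _ l0].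
  by rewrite (_ : ord_max = l) ?vl ?orbT //; apply: val_inj.
by rewrite (_ : ord0 = l) ?vl //; apply: val_inj.
Qed.

Lemma merge_is_cell m (B : {ffun 'I_m.+2 -> {set 'I_n}}) i :
  is_cell B -> is_cell (merge B i).
Proof.
move=> cB; have im := ltn_ord i.
pose p (l : 'I_m.+2) : 'I_m.+1 := inord (unbump i l).
have pE l : p l = unbump i l :> nat.
  by rewrite inordK //; have := ltn_ord l; rewrite /unbump; lia.
apply: (@is_cell_coarsen _ B p) => //.
- by apply: val_inj; rewrite /= pE /unbump /=; lia.
- move=> j; have jm := ltn_ord j.
  exists (inord (bump i j)); apply: val_inj.
  by rewrite /= pE inordK ?bumpK // /bump; lia.
move=> v j; rewrite in_merge; split=> -[l vl lj]; exists l => //.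
  by apply: val_inj; rewrite /= pE.
by rewrite -pE lj.
Qed.

Lemma wrap_is_cell m (B : {ffun 'I_m.+2 -> {set 'I_n}}) :
  is_cell B -> is_cell (wrap B).
Proof.
move=> cB.
pose p (l : 'I_m.+2) : 'I_m.+1 := inord (if l == m.+1 :> nat then 0%N else l).
have pE l : p l = (if l == m.+1 :> nat then 0%N else l) :> nat.
  by rewrite inordK //; have := ltn_ord l; case: eqP; lia.
apply: (@is_cell_coarsen _ B p) => //.
- by apply: val_inj; rewrite /= pE.
- move=> j; have jm := ltn_ord j; exists (inord j); apply: val_inj.
  by rewrite /= pE inordK; last lia; case: eqP; lia.
move=> v j; rewrite in_wrap; split=> -[l vl lj]; exists l => //.
  by apply: val_inj; rewrite /= pE.
by rewrite -pE lj.
Qed.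

Definition merge_cell m (B : cell m.+1) (i : 'I_m.+1) : cell m :=
  exist _ (merge (val B) i) (merge_is_cell i (valP B)).

Definition wrap_cell m (B : cell m.+1) : cell m :=
  exist _ (wrap (val B)) (wrap_is_cell (valP B)).

Definition face m (i : nat) (B : cell m.+1) : cell m :=
  if (i <= m)%N then merge_cell B (inord i) else wrap_cell B.

Definition face_idx m i l : nat :=
  if (i <= m)%N then unbump i l else if l == m.+1 then 0%N else l.

Lemma in_face m i (B : cell m.+1) j v :
  v \in val (face i B) j <-> exists2 l, v \in val B l & face_idx m i l = j.
Proof.
rewrite /face /face_idx; case: leqP => im; last exact: in_wrap.
by rewrite in_merge inordK.
Qed.

Lemma face_idxE m i l :
  [\/ [/\ (i <= m)%N, (l <= i)%N & face_idx m i l = l],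
      [/\ (i <= m)%N, (i < l)%N & face_idx m i l = l.-1],
      [/\ (m < i)%N, l = m.+1 & face_idx m i l = 0%N]
    | [/\ (m < i)%N, l <> m.+1 & face_idx m i l = l]].
Proof.
rewrite /face_idx /unbump; case: (leqP i m) => im.
  by case: (leqP l i) => li; [constructor 1|constructor 2]; split; rewrite ?subn0 ?subn1.
by case: eqP => li; [constructor 3 | constructor 4].
Qed.

Lemma face_idxK m i j l : (i < j < m.+3)%N -> (l < m.+3)%N ->
  face_idx m i (face_idx m.+1 j l) = face_idx m j.-1 (face_idx m.+1 i l).
Proof.
move=> ij lm.
case: (face_idxE m.+1 j l) => -[? ? E1];
case: (face_idxE m.+1 i l) => -[? ? E2]; rewrite {}E1 {}E2;
match goal with |- face_idx _ _ ?a = face_idx _ _ ?b =>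
  case: (face_idxE m i a) => -[? ? ->]; case: (face_idxE m j.-1 b) => -[? ? ->]
end; lia.
Qed.

Lemma face_idx_lt m i l : (l < m.+2)%N -> (face_idx m i l < m.+1)%N.
Proof. by move=> lm; case: (face_idxE m i l) => -[? ? ->]; lia. Qed.

Lemma faceK m i j (B : cell m.+2) : (i < j < m.+3)%N ->
  face i (face j B) = face j.-1 (face i B).
Proof.
move=> ij; apply: val_inj; apply/ffunP=> a; apply/setP=> v.
have E i' j' : v \in val (face i' (face j' B)) a <->
    exists2 l, v \in val B l & face_idx m i' (face_idx m.+1 j' l) = a.
  rewrite in_face; split=> [[b /in_face[l vl lb] ba]|[l vl la]].
    by exists l; rewrite // lb.
  exists (Ordinal (face_idx_lt j' (ltn_ord l))) => //.
  by apply/in_face; exists l.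
by apply/idP/idP => /E[l vl la]; apply/E; exists l => //; move: la;
  rewrite (face_idxK ij (ltn_ord l)).
Qed.

End Cells.

Section Homology.
Variables (F : fieldType) (n : nat) (H : {set {set 'I_n}}).

(* Indices are shifted by one to start at the degree r = -1:
   chain m = C_(m-1), cycles m = ker d_(m-1), boundaries m = im d_m and
   HC m = HC_(m-1), whereas bd r = d_r : C_r -> C_(r-1) for r >= 0. *)
Definition chain m := {ffun cell H m -> F^o}.

Definition basis_vec m (B : cell H m) : chain m := [ffun X => (X == B)%:R].

Definition bd_cell r (B : cell H r.+1) : chain r :=
  \sum_(i < r.+1) (-1) ^+ i.+2 *: basis_vec (merge_cell B i)
  + (-1) ^+ r.+3 *: basis_vec (wrap_cell B).

Definition bd_fun r (c : chain r.+1) : chain r :=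
  \sum_(B : cell H r.+1) (c B : F) *: bd_cell B.

Lemma bd_fun_is_linear r : linear (@bd_fun r).
Proof.
move=> a c d; rewrite /bd_fun scaler_sumr -big_split; apply: eq_bigr => B _ /=.
by rewrite !ffunE scalerDl scalerA.
Qed.

HB.instance Definition _ r :=
  GRing.isLinear.Build F (chain r.+1) (chain r) _ (@bd_fun r)
    (@bd_fun_is_linear r).

Definition bd r : 'Hom(chain r.+1, chain r) := linfun (@bd_fun r).

Lemma bd_basis r (B : cell H r.+1) : bd r (basis_vec B) = bd_cell B.
Proof.
rewrite lfunE /= /bd_fun (bigD1 B) //= ffunE eqxx scale1r big1 ?addr0 // => X XB.
by rewrite ffunE (negPf XB) scale0r.
Qed.

Lemma bd_cellE r (B : cell H r.+1) :
  bd_cell B = \sum_(i < r.+2) (-1) ^+ i *: basis_vec (face i B).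
Proof.
rewrite big_ord_recr /= /face ltnn; congr (_ + _); last first.
  by rewrite !exprS !mulN1r !opprK.
apply: eq_bigr => i _; rewrite !exprS !mulN1r opprK /=.
by rewrite -ltnS ltn_ord inord_val.
Qed.

Lemma bd_bd r (c : chain r.+2) : bd r (bd r.+1 c) = 0.
Proof.
rewrite [bd r.+1 c]lfunE /= /bd_fun linear_sum big1 // => B _.
rewrite linearZ /= bd_cellE linear_sum /=.
pose T (j i : nat) : chain r := (-1) ^+ (i + j) *: basis_vec (face i (face j B)).
rewrite (eq_bigr (fun j : 'I_r.+3 => \sum_(i < r.+2) T j i)); last first.
  move=> j _; rewrite linearZ /= bd_basis bd_cellE scaler_sumr.
  by apply: eq_bigr => i _; rewrite scalerA -exprD addnC.
rewrite pair_big /= (bigID (fun p : 'I_r.+3 * 'I_r.+2 => (p.2 < p.1)%N)) /=.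
set S := \sum_(p | ~~ _) _.
suff -> : \sum_(p : 'I_r.+3 * 'I_r.+2 | (p.2 < p.1)%N) T p.1 p.2 = - S.
  by rewrite addNr scaler0.
rewrite /S -sumrN.
pose f (p : 'I_r.+3 * 'I_r.+2) : 'I_r.+3 * 'I_r.+2 := (inord p.2, inord p.1.-1).
pose g (p : 'I_r.+3 * 'I_r.+2) : 'I_r.+3 * 'I_r.+2 := (inord p.2.+1, inord p.1).
have oE a (m : nat) : (m < a.+1)%N -> @inord a m = m :> nat by move/inordK.
rewrite (reindex_onto g f) /=; last first.
  move=> [j i] /= ij; have jr := ltn_ord j; have ir := ltn_ord i.
  have j1 := oE r.+1 j.-1; have i1 := oE r.+2 i.
  congr (_, _); apply: val_inj; rewrite /= oE; lia.
have gE (p : 'I_r.+3 * 'I_r.+2) : (p.1 <= p.2)%N ->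
    (g p).1 = p.2.+1 :> nat /\ (g p).2 = p.1 :> nat.
  by case: p => j i /= ji; have ir := ltn_ord i; split; rewrite oE //; lia.
apply: eq_big => [[j i]|[j i]] /=; have jr := ltn_ord j; have ir := ltn_ord i.
  rewrite -leqNgt; have i1 := oE r.+2 i.+1; case: (leqP j i) => ji.
    have /= [g1 g2] := gE (j, i) ji.
    rewrite g1 g2 ltnS ji /= /f /= xpair_eqE -!val_eqE /= g1 g2.
    by rewrite !oE ?eqxx //; lia.
  apply/negbTE; rewrite /f xpair_eqE -!val_eqE /= i1 //= ; apply/negP=> /andP[gi].
  have [jr1 | jr1] := ltnP j r.+2.
    by move: gi; rewrite oE //; lia.
  have := ltn_ord (@inord r.+1 j); move: gi; set q := nat_of_ord _ => ?? /andP[].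
  by rewrite oE; lia.
case/andP=> gi /eqP fg.
have ji : (j <= i)%N.
  have := congr1 (fun p => nat_of_ord p.1) fg; rewrite /= oE; last first.
    by have := ltn_ord (@inord r.+1 j); lia.
  by move=> jE; move: gi; rewrite /g /= (oE _ i.+1) // jE ltnS.
have /= [-> ->] := gE (j, i) ji.
by rewrite /T faceK ?ltnS ?ji //= addnS exprS mulN1r scaleNr addnC.
Qed.

Definition cycles m : {vspace chain m} :=
  match m with
  | 0 => fullv
  | r.+1 => lker (bd r)
  end.

Definition boundaries m : {vspace chain m} := limg (bd m).

Lemma boundaries_sub_cycles m : (boundaries m <= cycles m)%VS.
Proof.
case: m => [|r]; first exact: subvf.
by apply/subvP => _ /memv_imgP[c _ ->]; rewrite memv_ker bd_bd.
Qed.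

(* The quotient of the cycles by the boundaries, realised as a complement of
   the boundaries inside the cycles. *)
Definition HC m : {vspace chain m} := (cycles m :\: boundaries m)%VS.

Lemma HC_unique_repr m (z : chain m) : z \in cycles m ->
  exists! h, h \in HC m /\ z - h \in boundaries m.
Proof.
move=> zc; have := zc; rewrite -(addv_diff_cap (cycles m) (boundaries m)).
case/memv_addP=> h hH [b]; rewrite memv_cap => /andP[_ bB] zE.
exists h; split; first by split=> //; rewrite zE addrC addKr.
move=> h' [h'H zh']; apply/eqP; rewrite -subr_eq0 -memv0.
rewrite -(capv_diff (cycles m) (boundaries m)) memv_cap memvB //=.
have -> : h - h' = (z - h') - b by rewrite zE [h + b - h']addrAC addrK.
exact: memvB.
Qed.

End Homology.

(* Main.v *)
(* Cyclic ordered partitions are the cells of the torus of maps from the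
   vertices to the circle, modulo rotation, so the complex is the union of the
   subtori T_e of maps that are constant on the edge e.  Since k > n/2, the edges
   E_0, ..., E_(n-k) (in diagonal order) share a vertex b, which serves as base
   point: T_e consists of the maps that vanish on e.
   Let v be a vertex outside e.  Collapsing v to b splits off T_(e+v) from T_e,
   and the complement is the suspension of T_(e+v), by an explicit homotopy that
   moves v around the circle.  Hence dim H_j(T_e) = C(n - |e|, j).
   As T_(E_(i+1)) meets T_(E_0) + ... + T_(E_i) exactly in
   T_(E_i + E_(i+1)), where E_i + E_(i+1) is E_(i+1) plus one vertex, attaching
   it adds the complement above, of dimension C(n - k, j) - C(n - k - 1, j). *)

From HB Require Import structures.
Require Import Defs.
From mathcomp Require Import all_boot all_order all_algebra all_fingroup.
From mathcomp Require Import zify.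

Set Implicit Arguments.
Unset Strict Implicit.
Unset Printing Implicit Defensive.

Import GRing.Theory.
Local Open Scope ring_scope.

(** * Betti numbers of graded subspaces of one ambient space *)

Section GradedComplex.
Variables (F : fieldType) (A : vectType F) (D : nat -> 'End(A)).
Implicit Types (U Q : nat -> {vspace A}).

(** [D m] goes from degree [m.+1] to degree [m]. All degrees share the ambient space [A], so that no
    type depends on the degree; nothing leaves degree 0. *)
Definition cyc U m : {vspace A} :=
  if m is m'.+1 then (U m'.+1 :&: lker (D m'))%VS else U 0.

Definition bnd U m : {vspace A} := (D m @: U m.+1)%VS.

Definition betti U m : nat := (\dim (cyc U m) - \dim (bnd U m))%N.

Definition stable U := forall m x, x \in U m.+1 -> D m x \in U m.

(** Required on [U] only: off the cells the ambient operators need not square to zero. *)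
Definition square_zero U := forall m x, x \in U m.+2 -> D m (D m.+1 x) = 0.

Lemma memv_cycP U m x :
  reflect (x \in U m /\ (forall m', m = m'.+1 -> D m' x = 0)) (x \in cyc U m).
Proof.
case: m => [|m] /=; first by apply: (iffP idP) => [?|[]//]; split.
rewrite memv_cap memv_ker; apply: (iffP andP) => -[xU].
  by move/eqP=> Dx; split=> // m' [<-].
by move=> Dx; split=> //; apply/eqP/Dx.
Qed.

Lemma bnd_sub_cyc U m : stable U -> square_zero U -> (bnd U m <= cyc U m)%VS.
Proof.
move=> sU dU; apply/subvP => _ /memv_imgP[x xU ->].
by apply/memv_cycP; split=> [|m' mE]; [exact: sU | move: x xU; rewrite mE; apply: dU].
Qed.

(** If [D] kills [x1 + x2], then [D x1 = - D x2] lies in both summands, hence is 0; so cycles, like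
    boundaries, split. *)
Lemma betti_direct U U1 U2 m : square_zero U -> stable U1 -> stable U2 ->
    (forall l, U1 l + U2 l = U l)%VS -> (forall l, U1 l :&: U2 l = 0)%VS ->
  betti U m = (betti U1 m + betti U2 m)%N.
Proof.
move=> dU s1 s2 UE U0.
have sub1 l : (U1 l <= U l)%VS by rewrite -UE addvSl.
have sub2 l : (U2 l <= U l)%VS by rewrite -UE addvSr.
have d1 : square_zero U1 by move=> l x /(subvP (sub1 _)); apply: dU.
have d2 : square_zero U2 by move=> l x /(subvP (sub2 _)); apply: dU.
have ZE : cyc U m = (cyc U1 m + cyc U2 m)%VS.
  apply/eqP; rewrite eqEsubv; apply/andP; split; apply/subvP => x.
    case/memv_cycP; rewrite -UE => /memv_addP[x1 xU1 [x2 xU2 ->]] Dx.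
    apply: memv_add; apply/memv_cycP; split=> // m' mE; subst m;
      have/eqP := Dx _ erefl; rewrite linearD /= addr_eq0 => /eqP Dx1; apply/eqP;
      rewrite -memv0 -(U0 m') memv_cap.
      by rewrite s1 //= Dx1 rpredN s2.
    by rewrite s2 // andbT -rpredN -Dx1 s1.
  case/memv_addP=> x1 /memv_cycP[x1U Dx1] [x2 /memv_cycP[x2U Dx2] ->].
  apply/memv_cycP; split; first by rewrite -UE memv_add.
  by move=> m' mE; rewrite linearD /= Dx1 // Dx2 // addr0.
have BE : bnd U m = (bnd U1 m + bnd U2 m)%VS by rewrite /bnd -UE limgD.
have sum_dim (X Y : {vspace A}) : (X <= U1 m)%VS -> (Y <= U2 m)%VS ->
    \dim (X + Y) = (\dim X + \dim Y)%N.
  move=> X1 Y2; apply: dimv_disjoint_sum; apply/eqP; rewrite -subv0 -(U0 m).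
  exact: capvS.
have Z1 : (cyc U1 m <= U1 m)%VS by apply/subvP => x /memv_cycP[].
have Z2 : (cyc U2 m <= U2 m)%VS by apply/subvP => x /memv_cycP[].
have B1 := bnd_sub_cyc m s1 d1; have B2 := bnd_sub_cyc m s2 d2.
rewrite /betti ZE BE !sum_dim ?(subv_trans B1) ?(subv_trans B2) //.
by have := dimvS B1; have := dimvS B2; lia.
Qed.

(* [t] realises the suspension of [U] as a deformation retract of [Q]. *)
Lemma betti_suspension U Q (t q h : nat -> 'End(A)) m :
    square_zero U -> stable U -> square_zero Q -> stable Q ->
    (forall l x, x \in U l -> t l x \in Q l.+1) ->
    (forall l x, x \in Q l.+1 -> q l x \in U l) ->
    (forall l x, x \in Q l -> h l x \in Q l.+1) ->
    (forall x, x \in U 0 -> D 0 (t 0 x) = 0) ->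
    (forall l x, x \in U l.+1 -> D l.+1 (t l.+1 x) = t l (D l x)) ->
    (forall l x, x \in U l -> q l (t l x) = x) ->
    (forall l x, x \in Q l.+1 ->
       x - t l (q l x) = D l.+1 (h l.+1 x) + h l (D l x)) ->
  betti Q m.+1 = betti U m.
Proof.
move=> dU sU dQ sQ tQ qU hQ Dt0 DtS qt htp.
have t_inj l x : x \in U l -> t l x = 0 -> x = 0.
  by move=> xU tx; rewrite -(qt l x) // tx linear0.
(* [q] is a chain map: apply the injective [t] and compare the homotopy formula at [x] with the one
   at [D x]. *)
have qD l x : x \in Q l.+2 -> q l (D l.+1 x) = D l (q l.+1 x).
  move=> xQ; have Dx := sQ _ _ xQ; apply/eqP; rewrite -subr_eq0; apply/eqP.
  apply: (@t_inj l); first by rewrite rpredB ?qU ?sU ?qU.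
  have e1 := htp _ _ Dx; have e2 := htp _ _ xQ.
  rewrite linearB /= -DtS ?qU //.
  have -> : t l.+1 (q l.+1 x) = x - D l.+2 (h l.+2 x) - h l.+1 (D l.+1 x).
    by rewrite -addrA -opprD -e2 opprB addrC subrK.
  have -> : t l (q l (D l.+1 x)) = D l.+1 x - D l.+1 (h l.+1 (D l.+1 x)).
    by move: e1; rewrite dQ // linear0 addr0 => <-; rewrite opprB addrC subrK.
  rewrite !linearB /= (dQ _ _ (hQ _ _ xQ)) oppr0 subr0 opprK.
  by rewrite [- _ + _]addrC addrA subrK subrr.
(* The homotopy shows that a cycle [x] equals [t (q x)] modulo boundaries. *)
have Z_E : cyc Q m.+1 = (t m @: cyc U m + bnd Q m.+1)%VS.
  apply/eqP; rewrite eqEsubv; apply/andP; split; apply/subvP => x.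
    case/memv_cycP=> xQ /(_ m erefl) Dx.
    have := htp _ _ xQ; rewrite Dx linear0 addr0 => /eqP; rewrite subr_eq addrC => /eqP->.
    apply: memv_add; apply: memv_img; last exact: hQ.
    apply/memv_cycP; split; first exact: qU.
    by move=> m' mE; subst m; rewrite -qD // Dx linear0.
  case/memv_addP=> _ /memv_imgP[y /memv_cycP[yU Dy] ->] [_ /memv_imgP[w wQ ->] ->].
  apply/memv_cycP; split; first by rewrite rpredD ?tQ ?sQ.
  move=> _ [<-]; rewrite linearD /= dQ // addr0.
  case: m yU Dy {wQ} => [|m'] yU Dy; first exact: Dt0.
  by rewrite DtS // Dy // linear0.
(* A boundary in the image of [t] is pulled back by [q] to a boundary of [U]. *)
have cap_E : (t m @: cyc U m :&: bnd Q m.+1)%VS = (t m @: bnd U m)%VS.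
  apply/eqP; rewrite eqEsubv; apply/andP; split; apply/subvP => x.
    rewrite memv_cap => /andP[/memv_imgP[y /memv_cycP[yU _] ->] /memv_imgP[w wQ ty]].
    apply: memv_img; rewrite -(qt _ _ yU) ty qD //.
    by apply: memv_img; apply: qU.
  case/memv_imgP=> _ /memv_imgP[y yU ->] ->; rewrite memv_cap; apply/andP; split.
    by apply: memv_img; apply: (subvP (bnd_sub_cyc m sU dU)); apply: memv_img.
  by rewrite -DtS //; apply: memv_img; apply: tQ.
have dim_t (X : {vspace A}) : (X <= U m)%VS -> \dim (t m @: X) = \dim X.
  move=> XU; apply: limg_dim_eq; apply/eqP; rewrite -subv0; apply/subvP => x.
  by rewrite memv_cap memv_ker memv0 => /andP[/(subvP XU) xU /eqP tx]; apply/eqP/t_inj/tx.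
have ZU : (cyc U m <= U m)%VS by apply/subvP => x /memv_cycP[].
have BU := bnd_sub_cyc m sU dU; have BQ := bnd_sub_cyc m.+1 sQ dQ.
have := dimv_sum_cap (t m @: cyc U m) (bnd Q m.+1).
rewrite -Z_E cap_E !dim_t ?(subv_trans BU) // /betti.
by have := dimvS BU; have := dimvS BQ; lia.
Qed.

Lemma eq_betti U V m :
  (forall l, U l = V l) -> betti U m = betti V m.
Proof. by move=> UV; rewrite /betti /bnd UV; congr (\dim _ - _)%N; case: m => *; rewrite /= UV. Qed.

End GradedComplex.

(** * Free vector spaces and their coordinate subspaces *)

Section FreeSpace.
Variables (F : fieldType) (T : finType).
Local Notation free_space := {ffun T -> F^o}.
Implicit Types (P Q : pred T) (c : free_space).

Definition delta x : free_space := [ffun y => (y == x)%:R].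

Lemma scale_deltaE (a : F) x y : (a *: delta x) y = if y == x then a else 0.
Proof.
by rewrite !ffunE; case: eqP => _; [exact: mulr1 | exact: mulr0].
Qed.

Lemma delta_sum c : c = \sum_x (c x : F) *: delta x.
Proof.
apply/ffunP => y; rewrite sum_ffunE (bigD1 y) //= scale_deltaE eqxx big1 ?addr0 //.
by move=> x xy; rewrite scale_deltaE eq_sym (negPf xy).
Qed.

Section Extend.
Variables (W : vectType F) (phi : T -> W).

Definition extend_fun c : W := \sum_x (c x : F) *: phi x.

Lemma extend_fun_is_linear : linear extend_fun.
Proof.
move=> a c d; rewrite /extend_fun scaler_sumr -big_split; apply: eq_bigr => x _ /=.
by rewrite !ffunE scalerDl scalerA.
Qed.

HB.instance Definition _ :=
  GRing.isLinear.Build F free_space W _ extend_fun extend_fun_is_linear.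

Definition extend : 'Hom(free_space, W) := linfun extend_fun.

Lemma extendE c : extend c = \sum_x (c x : F) *: phi x.
Proof. by rewrite lfunE. Qed.

Lemma extend_delta x : extend (delta x) = phi x.
Proof.
rewrite extendE (bigD1 x) //= ffunE eqxx scale1r big1 ?addr0 // => y yx.
by rewrite ffunE (negPf yx) scale0r.
Qed.

End Extend.

(** The span of the [delta x] with [P x], as the kernel of the projection that erases these
    coordinates. *)
Definition coord_space P : {vspace free_space} :=
  lker (extend (fun x => if P x then 0 else delta x)).

Lemma coord_spaceP P c :
  reflect (forall x, ~~ P x -> c x = 0) (c \in coord_space P).
Proof.
rewrite memv_ker extendE; apply: (iffP eqP) => [c0 x Px|c0].
  have := congr1 (fun d : free_space => d x) c0; rewrite /= sum_ffunE (bigD1 x) //=.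
  rewrite (negPf Px) scale_deltaE eqxx big1 ?addr0 => [->|y yx]; first by rewrite ffunE.
  by case: ifP => _; rewrite ?scaler0 ?scale_deltaE ?ffunE // eq_sym (negPf yx).
rewrite big1 // => x _; case: ifPn => [_|/c0->]; first by rewrite scaler0.
by rewrite scale0r.
Qed.

Lemma coord_spaceE P c : c \in coord_space P -> c = \sum_(x | P x) (c x : F) *: delta x.
Proof.
move/coord_spaceP=> cP; rewrite {1}(delta_sum c) (bigID P) /= [X in _ + X]big1 ?addr0 //.
by move=> x /cP->; rewrite scale0r.
Qed.

Lemma delta_coord_space P x : P x -> delta x \in coord_space P.
Proof.
by move=> Px; apply/coord_spaceP => y; rewrite ffunE; case: eqP => // ->; rewrite Px.
Qed.

Lemma coord_spaceS P Q : subpred P Q -> (coord_space P <= coord_space Q)%VS.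
Proof.
move=> PQ; apply/subvP => c /coord_spaceP cP; apply/coord_spaceP => x Qx.
by apply: cP; apply: contra Qx; apply: PQ.
Qed.

Lemma coord_space_cap P Q :
  (coord_space P :&: coord_space Q)%VS = coord_space [pred x | P x && Q x].
Proof.
apply/vspaceP => c; rewrite memv_cap; apply/andP/coord_spaceP => /=.
  by case=> /coord_spaceP cP /coord_spaceP cQ x; rewrite negb_and => /orP[/cP|/cQ].
by move=> cPQ; split; apply/coord_spaceP => x nx; apply: cPQ; rewrite negb_and nx ?orbT.
Qed.

Lemma coord_space_add P Q :
  (coord_space P + coord_space Q)%VS = coord_space [pred x | P x || Q x].
Proof.
apply/eqP; rewrite eqEsubv subv_add !coord_spaceS /=; try by move=> x /= ->; rewrite ?orbT.
apply/subvP => c /coord_spaceE->; apply: rpred_sum => x /= /orP[Px|Qx]; apply: rpredZ.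
  by apply: (subvP (addvSl _ _)); apply: delta_coord_space.
by apply: (subvP (addvSr _ _)); apply: delta_coord_space.
Qed.

Lemma eq_coord_space P Q : P =1 Q -> coord_space P = coord_space Q.
Proof.
move=> PQ; apply/eqP; rewrite eqEsubv !coord_spaceS // => x; by rewrite PQ.
Qed.

Lemma coord_space_ind P (W : vectType F) (f g : 'Hom(free_space, W)) :
  (forall x, P x -> f (delta x) = g (delta x)) ->
  {in coord_space P, f =1 g}.
Proof.
move=> fg c /coord_spaceE->; rewrite !linear_sum; apply: eq_bigr => x Px.
by rewrite !linearZ /= fg.
Qed.

Lemma coord_space_img P (W : vectType F) (f : 'Hom(free_space, W)) (X : {vspace W}) :
  (forall x, P x -> f (delta x) \in X) -> {in coord_space P, forall c, f c \in X}.
Proof.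
move=> fX c /coord_spaceE->; rewrite linear_sum; apply: rpred_sum => x Px.
by rewrite linearZ /= rpredZ // fX.
Qed.

End FreeSpace.

Arguments delta {F T} x.
Arguments coord_space {F T} P.

(* The position of [l] among [M] cyclically arranged positions read from [a]. *)
Definition crot M a l : nat := if (a <= l)%N then (l - a)%N else (l + M - a)%N.

(** The wrap merges the last block with block 0, so all faces are cyclically alike: reading from [a]
    turns face [i] into face [i - a] (cyclically), and the new origin is the image of [a]. *)
Lemma crot_face_idx m a i l : (a < m.+2)%N -> (i < m.+2)%N -> (l < m.+2)%N ->
  face_idx m (crot m.+2 a i) (crot m.+2 a l) =
    crot m.+1 (face_idx m i a) (face_idx m i l).
Proof.
move=> am im lm.
have r_lt x : (x < m.+2)%N -> (crot m.+2 a x < m.+2)%N by rewrite /crot; case: ifP; lia.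
have ri := r_lt _ im; have rl := r_lt _ lm; move: ri rl.
case: (face_idxE m (crot m.+2 a i) (crot m.+2 a l)) => -[]; rewrite /crot;
  case: (leqP a i) => ?; case: (leqP a l) => ? ? ? -> ? ?;
  case: (face_idxE m i a) => -[? ? ->]; case: (face_idxE m i l) => -[? ? ->];
  case: leqP; lia.
Qed.

(** Reading [m.+2] blocks from [a] costs the sign [(-1) ^+ (m.+1 * a)], and after a face [m]
    replaces [m.+1]; the identity makes [rebase] a chain map. *)
Lemma crot_sign m a i (R : pzRingType) : (a < m.+2)%N -> (i < m.+2)%N ->
  (-1) ^+ (m.+1 * a + crot m.+2 a i) = (-1) ^+ (i + m * face_idx m i a) :> R.
Proof.
move=> am im; rewrite /crot mulSn.
case: (face_idxE m i a) => -[mi ia ->]; case: leqP => ai; try lia.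
- by rewrite addnAC subnKC // addnC.
- have -> : (a + m * a + (i + m.+2 - a) = i + m * a.-1 + m.+1.*2)%N.
    by case: a am ia ai => // a am ia ai; rewrite /= mulnS -addnn; lia.
  by rewrite exprD -mul2n exprM sqrrN !expr1n mulr1.
(* Here [a = i = m.+1], and [m.+1 * m.+1] has the parity of [m.+1]. *)
- rewrite ia in ai *; have -> : i = m.+1 by lia.
  by rewrite subnn muln0 !addn0 -[LHS]signr_odd oddD oddM /= andbN addbF -[RHS]signr_odd.
- by rewrite addnAC subnKC // addnC.
Qed.

Lemma ord_sub_crot m (x y : 'I_m.+1) : (x - y : 'I_m.+1) = crot m.+1 y x :> nat.
Proof.
have xm := ltn_ord x; have ym := ltn_ord y.
rewrite /= modnDmr /crot; case: leqP => yx.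
  by rewrite (_ : (x + (m.+1 - y) = (x - y) + m.+1)%N) ?modnDr ?modn_small //; lia.
by rewrite modn_small; lia.
Qed.

(** [crot m.+1 a 0] is where the old origin lands; reading from there undoes the rotation. *)
Lemma crotK m a l : (a < m.+1)%N -> (l < m.+1)%N ->
  crot m.+1 (crot m.+1 a 0) (crot m.+1 a l) = l.
Proof. by rewrite /crot => am lm; case: (leqP a 0) => ?; case: (leqP a l) => ?; case: leqP; lia. Qed.

Lemma crot_lt m a l : (a < m.+1)%N -> (l < m.+1)%N -> (crot m.+1 a l < m.+1)%N.
Proof. by rewrite /crot => am lm; case: (leqP a l); lia. Qed.

Lemma crotKV m a l : (a < m.+1)%N -> (l < m.+1)%N -> exists2 i, (i < m.+1)%N & crot m.+1 a i = l.
Proof.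
move=> am lm; exists (crot m.+1 (crot m.+1 a 0) l); first by rewrite !crot_lt.
by rewrite /crot; case: (leqP a 0) => ?; case: (leqP _ l) => ?; case: leqP; lia.
Qed.

Ltac face_idx_cases := repeat match goal with
  |- context [face_idx ?m ?i ?l] =>
    lazymatch l with
    | context [face_idx _ _ _] => fail
    | _ => case: (face_idxE m i l) => -[? ? ->]
    end
  end; try lia.

(** * Placements of the vertices on the circle, and their differential *)

Section Model.
Variables (F : fieldType) (n : nat) (b : 'I_n).
Local Notation positions := {ffun 'I_n -> nat}.
Local Notation word := {ffun 'I_n -> 'I_n.+1}.
Local Notation chains := {ffun word -> F^o}.
Implicit Types (f : positions) (w : word) (m i l : nat) (Z : pred positions).

(* A cell with blocks [0 .. m] is encoded by the positions of the vertices, the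
   base vertex [b] being at 0.  Faces are computed on [nat]-valued positions;
   [word] is a finite type, large enough since cells have at most [n] blocks. *)
Definition code f : word := [ffun u => inord (f u)].
Definition decode w : positions := [ffun u => nat_of_ord (w u)].

Lemma decodeK : cancel decode code.
Proof. by move=> w; apply/ffunP => u; rewrite !ffunE inord_val. Qed.

Definition onto m f : bool :=
  [&& f b == 0%N, [forall u, (f u <= m)%N] & [forall j : 'I_m.+1, exists u, f u == j]].

Lemma ontoP m f :
  reflect [/\ f b = 0%N, forall u, (f u <= m)%N &
              forall j, (j <= m)%N -> exists u, f u = j] (onto m f).
Proof.
apply: (iffP and3P) => -[].
  move=> /eqP fb /forallP fm /forallP fs; split=> // j jm.
  have /existsP[u /eqP fu] := fs (inord j).
  by exists u; rewrite fu inordK.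
move=> fb fm fs; split; [exact/eqP | exact/forallP |].
by apply/forallP => j; have [u fu] := fs j (leq_ord j); apply/existsP; exists u; apply/eqP.
Qed.

Lemma onto_lt m f : onto m f -> (m < n)%N.
Proof.
case/ontoP=> _ _ fs.
have/fin_all_exists[p fp] (j : 'I_m.+1) : exists u, f u = j by apply/fs/leq_ord.
have p_inj : injective p by move=> i j pij; apply: val_inj; rewrite /= -!fp pij.
by have := leq_card p p_inj; rewrite !card_ord.
Qed.

Lemma codeK m f : onto m f -> decode (code f) = f.
Proof.
move=> fo; have mn := onto_lt fo; case/ontoP: fo => _ fm _.
by apply/ffunP => u; rewrite !ffunE inordK // ltnS (leq_trans (fm u)) // ltnW.
Qed.

(* Placements that leave a block empty are degenerate and are set to 0. *)
Definition gen m f : chains := if onto m f then delta (code f) else 0.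

(** At a word that encodes no cell the value has no meaning, so identities between operators are
    proved on [cell_space] only. *)
Definition oper (phi : positions -> chains) : 'End(chains) := extend (phi \o decode).

Lemma oper_gen phi m f : onto m f -> oper phi (gen m f) = phi f.
Proof. by move=> fo; rewrite /gen fo extend_delta /= (codeK fo). Qed.

Lemma oper_gen_if phi m f : oper phi (gen m f) = if onto m f then phi f else 0.
Proof. by case: ifPn => [/oper_gen//|/negPf fo]; rewrite /gen fo linear0. Qed.

Lemma gen_decode m w : onto m (decode w) -> gen m (decode w) = delta w.
Proof. by rewrite /gen decodeK => ->. Qed.

Definition glue m i f : positions := [ffun u => face_idx m i (f u)].

Definition diff m : 'End(chains) :=
  oper (fun f => \sum_(i < m.+2) (-1) ^+ i *: gen m (glue m i f)).

Lemma face_idx0 m i : face_idx m i 0 = 0%N.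
Proof. by case: (face_idxE m i 0) => -[]; lia. Qed.

Lemma onto_glue m i f : onto m.+1 f -> onto m (glue m i f).
Proof.
case/ontoP=> fb fm fs; apply/ontoP; split=> [|u|j jm]; rewrite ?ffunE ?fb ?face_idx0 //.
  by rewrite -ltnS face_idx_lt // ltnS.
(* Beyond the merged pair, block [j] of the face comes from block [j.+1]. *)
pose l := if (i <= m)%N && (i < j)%N then j.+1 else j.
have [|u fu] := fs l; first by rewrite /l; case: ifP; lia.
exists u; rewrite ffunE fu /l.
by case: ifPn => ij; case: (face_idxE m i l); rewrite /l ?(negPf ij) ?ij => -[]; lia.
Qed.

(** The empty block is not block 0, which contains [b]. *)
Lemma not_onto m f : f b = 0%N -> (forall u, (f u <= m)%N) -> ~~ onto m f ->
  exists x, [/\ (0 < x)%N, (x <= m)%N & forall u, f u <> x].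
Proof.
move=> fb fm; rewrite /onto fb eqxx /= negb_and => /orP[/forallPn[u]|/forallPn[j]].
  by rewrite fm.
move/existsPn=> fj; exists j; split; last by move=> u; apply/eqP.
  by case: (posnP j) => // j0; have := fj b; rewrite fb j0.
exact: leq_ord.
Qed.

Lemma missing_not_onto m f x : (x <= m)%N -> (forall u, f u <> x) -> gen m f = 0.
Proof.
move=> xm fx; rewrite /gen; case: ifP => // /ontoP[_ _ /(_ x xm)[u fu]].
by have := fx u.
Qed.

(* The degenerate placements span a subcomplex: if block [x] is empty, the
   faces [x - 1] and [x] coincide and the others are degenerate. *)
Lemma diff_gen m f : f b = 0%N -> (forall u, (f u <= m.+1)%N) ->
  diff m (gen m.+1 f) = \sum_(i < m.+2) (-1) ^+ i *: gen m (glue m i f).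
Proof.
move=> fb fm; case: (boolP (onto m.+1 f)) => fo; first exact: oper_gen.
(* After the shift of [x] the empty block is [x.+1], and faces [x] and [x.+1] form the cancelling
   pair. *)
have [x [x0 xm fx]] := not_onto fb fm fo; case: x x0 xm fx => // x _ xm fx.
rewrite {1}/gen (negPf fo) linear0.
have xi : @inord m.+1 x = x :> nat by rewrite inordK //; lia.
have xi1 : @inord m.+1 x.+1 = x.+1 :> nat by rewrite inordK //; lia.
rewrite (bigD1 (inord x)) //= (bigD1 (inord x.+1)) /=; last first.
  by rewrite -val_eqE /= xi xi1; lia.
have -> : glue m (@inord m.+1 x.+1) f = glue m (@inord m.+1 x) f.
  apply/ffunP => u; rewrite !ffunE xi xi1; have := fx u; have := fm u.
  by face_idx_cases.
rewrite xi xi1 big1 => [|i]; last first.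
  rewrite -!val_eqE /= xi xi1 => /andP[ix ix1].
  have im := ltn_ord i.
  (* A merge below the empty block [x.+1] moves it down to [x]. *)
  rewrite (@missing_not_onto _ _ (if (i < x)%N then x else x.+1)) ?scaler0 //.
    by case: ifP; lia.
  move=> u; rewrite ffunE; have := fx u; have := fm u.
  by case: (face_idxE m i (f u)) => -[? ? ->]; case: ifP; lia.
by rewrite exprS mulN1r scaleNr addr0 subrr.
Qed.

(** With two blocks, merge and wrap give the same single block, with opposite signs. *)
Lemma diff0_gen f : onto 1 f -> diff 0 (gen 1 f) = 0.
Proof.
move=> fo; rewrite /diff oper_gen // big_ord_recr big_ord1 /= expr0 expr1 scale1r scaleN1r.
suff -> : glue 0 0 f = glue 0 1 f by rewrite subrr.
case/ontoP: fo => _ fm _; apply/ffunP => u; rewrite !ffunE; have := fm u.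
by face_idx_cases.
Qed.

(** * Moving one vertex around the circle *)

Section Sweep.
Variable v : 'I_n.

Definition put l f : positions := [ffun u => if u == v then l else f u].

(* [v] becomes a block of its own, right after block [l] of the others. *)
Definition ins l f : positions :=
  [ffun u => if u == v then l.+1 else bump l.+1 (f u)].

(** The prism over the motion of [v] from block 0 to block [i]: one signed cell for each gap
    crossed. *)
Definition sweep m i f : chains := \sum_(l < i) (-1) ^+ l *: gen m.+1 (ins l f).

Lemma sweep_recr m i f : sweep m i.+1 f = sweep m i f + (-1) ^+ i *: gen m.+1 (ins i f).
Proof. exact: big_ord_recr. Qed.

Lemma ins_le m l f : (l <= m)%N -> (forall u, (f u <= m)%N) ->
  forall u, (ins l f u <= m.+1)%N.
Proof.
move=> lm fm u; rewrite ffunE /bump; have := fm u; case: ifP; lia.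
Qed.

Lemma glue_ins_lt m l j f : (j < l)%N -> (l <= m.+1)%N -> (forall u, (f u <= m.+1)%N) ->
  glue m.+1 j (ins l f) = ins l.-1 (glue m j f).
Proof.
move=> jl lm fm; apply/ffunP => u; rewrite !ffunE; have := fm u; case: ifP => _ ?;
  rewrite /bump; face_idx_cases.
Qed.

Lemma glue_ins_gt m l j f : (l < j)%N -> (j <= m.+1)%N -> (forall u, (f u <= m.+1)%N) ->
  glue m.+1 j.+1 (ins l f) = ins l (glue m j f).
Proof.
move=> jl lm fm; apply/ffunP => u; rewrite !ffunE; have := fm u; case: ifP => _ ?;
  rewrite /bump; face_idx_cases.
Qed.

Lemma glue_ins_eq m l f : (l <= m)%N -> (forall u, (f u <= m)%N) ->
  glue m l (ins l f) = put l f.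
Proof.
move=> lm fm; apply/ffunP => u; rewrite !ffunE; have := fm u; case: ifP => _ ?;
  rewrite /bump; face_idx_cases.
Qed.

(** The block after the last one is block 0, whence the reduction modulo [m.+1]. *)
Lemma glue_ins_eqS m l f : (l <= m)%N -> (forall u, (f u <= m)%N) ->
  glue m l.+1 (ins l f) = put (l.+1 %% m.+1) f.
Proof.
move=> lm fm; have -> : (l.+1 %% m.+1 = if l == m then 0 else l.+1)%N.
  by case: eqP => [->|lm1]; rewrite ?modnn // modn_small //; lia.
apply/ffunP => u; rewrite !ffunE; have := fm u; case: ifP => _ ?;
  rewrite /bump; case: (l =P m) => ?; face_idx_cases.
Qed.

Hypothesis vb : v != b.

Lemma ins_b l f : f b = 0%N -> ins l f b = 0%N.
Proof. by move=> fb; rewrite ffunE eq_sym (negPf vb) fb. Qed.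

(** Two faces absorb the block of [v] into a neighbour. The others come from the faces [j] of [f];
    [j = l] is missing because [v] separates block [l] from the next one. *)
Lemma diff_ins m l f : f b = 0%N -> (forall u, (f u <= m.+1)%N) -> (l <= m.+1)%N ->
  diff m.+1 (gen m.+2 (ins l f)) =
    (-1) ^+ l *: (gen m.+1 (put l f) - gen m.+1 (put (l.+1 %% m.+2) f))
    + \sum_(j < m.+2 | j != l :> nat) (-1) ^+ (if (j < l)%N then j : nat else j.+1) *:
        gen m.+1 (ins (if (j < l)%N then l.-1 else l) (glue m j f)).
Proof.
move=> fb fm lm; rewrite diff_gen ?ins_b //; last exact: ins_le.
have li : @inord m.+1 l = l :> nat by rewrite inordK.
have li2 : @inord m.+2 l = l :> nat by rewrite inordK //; lia.
rewrite (bigD1_ord (inord l)) //= (bigD1 (inord l)) //= li li2 addrA; congr (_ + _).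
  rewrite /bump leqnn add1n glue_ins_eq // glue_ins_eqS // exprS mulN1r scaleNr.
  by rewrite -scalerBr.
apply: eq_big => j; first by rewrite -val_eqE /= li.
rewrite -val_eqE /= li => jl; have := ltn_ord j; rewrite ltnS => jm.
rewrite /bump; case: ltnP => lj /=; first by rewrite add0n glue_ins_lt.
by rewrite add1n glue_ins_gt //; lia.
Qed.

(* Moving [v] forward from position 0 to position [i]; the endpoint is read
   cyclically, so that [i = m.+2] is the full turn. *)
Lemma diff_sweep m i f : f b = 0%N -> (forall u, (f u <= m.+1)%N) -> (i <= m.+2)%N ->
  diff m.+1 (sweep m.+1 i f) =
    gen m.+1 (put 0 f) - gen m.+1 (put (i %% m.+2) f)
    - \sum_(j < m.+2) (-1) ^+ j *: sweep m (i - (j < i)%N) (glue m j f).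
Proof.
move=> fb fm; elim: i => [|i IHi] im.
  rewrite mod0n subrr add0r /sweep big_ord0 linear0 big1 ?oppr0 // => j _.
  by rewrite ltn0 big_ord0 scaler0.
rewrite sweep_recr linearD /= IHi; last lia.
rewrite linearZ /= diff_ins // scalerDr scalerA -expr2 sqrr_sign scale1r.
(* The end positions telescope. *)
rewrite modn_small // addrACA subrKA; congr (_ + _).
(* From [i] to [i.+1] the sweep in face [j] gains one term, except for [j = i], where the bound
   stays [i]. *)
have -> : \sum_(j < m.+2) (-1) ^+ j *: sweep m (i.+1 - (j < i.+1)%N) (glue m j f) =
  \sum_(j < m.+2) (-1) ^+ j *: sweep m (i - (j < i)%N) (glue m j f) -
  (-1) ^+ i *:
  \sum_(j < m.+2 | j != i :> nat) (-1) ^+ (if (j < i)%N then j : nat else j.+1) *: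
        gen m.+1 (ins (if (j < i)%N then i.-1 else i) (glue m j f)); last first.
  by rewrite opprB addrC.
rewrite scaler_sumr -sumrN [X in _ + X]big_mkcond -big_split; apply: eq_bigr => j _ /=.
rewrite ltnS; case: (ltngtP j i) => ij /=.
- case: i ij {IHi im} => // i ij; rewrite !subn1 /= sweep_recr scalerDr; congr (_ + _).
  by rewrite !scalerA exprS mulN1r mulNr scaleNr opprK mulrC.
- rewrite !subn0 sweep_recr scalerDr; congr (_ + _).
  by rewrite !scalerA exprS mulN1r mulrN scaleNr opprK mulrC.
by rewrite subn0 subn1 addr0.
Qed.

End Sweep.

(** For [b] in [e], this selects the cells of the subtorus of maps constant on [e]. *)
Definition zero_on (e : {set 'I_n}) (f : positions) := [forall u in e, f u == 0%N].

Definition cell_space (Z : pred positions) m : {vspace chains} :=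
  coord_space [pred w : word | onto m (decode w) && Z (decode w)].

(** * Identification of the cyclic coloring complex with placements based at [b] *)

Section Rebase.
Variable H : {set {set 'I_n}}.
Hypothesis Hb : forall e, e \in H -> b \in e.

Definition some_zero (f : positions) := [exists e in H, zero_on e f].

(** The default [ord0] is never reached, as the blocks cover all vertices. *)
Definition block m (B : cell H m) u : 'I_m.+1 := odflt ord0 [pick j | u \in val B j].

Lemma mem_block m (B : cell H m) u : u \in val B (block B u).
Proof.
rewrite /block; case: pickP => //= uB; case/and5P: (valP B) => _ _ /eqP cov _ _.
have : u \in \bigcup_i val B i by rewrite cov inE.
by case/bigcupP => i _ ui; have := uB i; rewrite (ui : u \in sval B i).
Qed.

Lemma block_uniq m (B : cell H m) u j : u \in val B j -> block B u = j.
Proof.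
move=> uj; case/and5P: (valP B) => _ /forallP/(_ (block B u))/forallP/(_ j) dis _ _ _.
apply/eqP; apply: contraLR dis => bj; rewrite negb_imply bj /=.
by apply/pred0Pn; exists u; rewrite /= mem_block.
Qed.

Lemma mem_blockE m (B : cell H m) u j : (u \in val B j) = (block B u == j).
Proof. by apply/idP/eqP => [/block_uniq//|<-]; apply: mem_block. Qed.

Lemma block_face m i (B : cell H m.+1) u :
  block (face i B) u = face_idx m i (block B u) :> nat.
Proof.
have lt := face_idx_lt i (ltn_ord (block B u)).
rewrite (@block_uniq _ _ _ (Ordinal lt)) //; apply/in_face.
by exists (block B u); first exact: mem_block.
Qed.

Lemma block_zero m (B : cell H m) (z : 'I_n) : val z = 0%N -> block B z = ord0.
Proof.
move=> z0; apply: block_uniq; case/and5P: (valP B) => _ _ _ _ /existsP[y /andP[yB /eqP y0]].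
by rewrite (_ : z = y) //; apply: val_inj; rewrite z0.
Qed.

Definition pos m (B : cell H m) : positions :=
  [ffun u => crot m.+1 (block B b) (block B u)].

Lemma pos_onto m (B : cell H m) : onto m (pos B).
Proof.
apply/ontoP; split=> [|u|j jm]; rewrite ?ffunE.
- by rewrite /crot leqnn subnn.
- by rewrite -ltnS crot_lt.
have [//|i im ij] := @crotKV m (block B b) j (ltn_ord _).
case/and5P: (valP B) => /forallP/(_ (inord i))/set0Pn[u uB] _ _ _ _.
by exists u; rewrite ffunE (block_uniq uB) inordK.
Qed.

Lemma pos_zero m (B : cell H m) : some_zero (pos B).
Proof.
case/and5P: (valP B) => _ _ _ /existsP[i /existsP[e /andP[eH eB]]] _.
apply/existsP; exists e; rewrite eH; apply/forall_inP => u ue; rewrite ffunE.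
rewrite (block_uniq (subsetP eB _ ue)) (block_uniq (subsetP eB _ (Hb eH))).
by rewrite /crot leqnn subnn.
Qed.

(** Vertex 1 lies in block 0, so its position records the rotation; undoing it recovers the
    blocks. *)
Lemma pos_inj m : injective (@pos m).
Proof.
move=> B C BC; have n0 : (0 < n)%N by apply: leq_ltn_trans (ltn_ord b).
pose z := Ordinal n0.
have blockE (X : cell H m) u : block X u = crot m.+1 (pos X z) (pos X u) :> nat.
  by rewrite !ffunE (block_zero X (z := z)) // crotK.
apply: val_inj; apply/ffunP => j; apply/setP => u; rewrite !mem_blockE.
by rewrite -!val_eqE /= !blockE BC.
Qed.

Lemma pos_surj m f : onto m f -> some_zero f -> exists B : cell H m, pos B = f.
Proof.
case/ontoP => fb fm fs /existsP[e /andP[eH /forall_inP fe]].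
have n0 : (0 < n)%N by apply: leq_ltn_trans (ltn_ord b).
pose z := Ordinal n0.
have fm' u : (f u < m.+1)%N by rewrite ltnS.
(* The blocks are read starting from the one that contains vertex 1. *)
pose B : {ffun 'I_m.+1 -> {set 'I_n}} := [ffun j => [set u | crot m.+1 (f z) (f u) == val j]].
have inB u j : (u \in B j) = (crot m.+1 (f z) (f u) == val j) by rewrite ffunE inE.
have cB : is_cell H B.
  apply/and5P; split.
  - apply/forallP => j; have [//|i im ij] := @crotKV m (f z) j (fm' z).
    by have [u fu] := fs i im; apply/set0Pn; exists u; rewrite inB fu ij.
  - apply/forallP => i; apply/forallP => j; apply/implyP; apply: contraR => /pred0Pn[u] /=.
    by rewrite !inB => /andP[/eqP-> ].
  - apply/eqP/setP => u; rewrite inE; apply/bigcupP.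
    exists (inord (crot m.+1 (f z) (f u))) => //.
    by rewrite inB /= inordK // crot_lt.
  - apply/existsP; exists (inord (crot m.+1 (f z) 0)); apply/existsP; exists e.
    rewrite eH; apply/subsetP => u ue; rewrite inB (eqP (fe u ue)) /= inordK //.
    by rewrite crot_lt.
  by apply/existsP; exists z; rewrite inB /= /crot leqnn subnn.
pose C : cell H m := exist _ B cB.
have bC u : block C u = crot m.+1 (f z) (f u) :> nat.
  rewrite (@block_uniq _ C u (inord (crot m.+1 (f z) (f u)))) ?inordK ?crot_lt //.
  by rewrite /= inB /= inordK // crot_lt.
by exists C; apply/ffunP => u; rewrite ffunE !bC fb crotK.
Qed.

(* Moving the base vertex from 1 to [b] rotates the blocks. *)
Definition rebase m : 'Hom(chain F H m, chains) :=
  extend (fun B : cell H m => (-1) ^+ (m * block B b) *: gen m (pos B)).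

Lemma rebase_basis m (B : cell H m) :
  rebase m (basis_vec F B) = (-1) ^+ (m * block B b) *: gen m (pos B).
Proof. exact: extend_delta. Qed.

Lemma rebase_bd m c : rebase m (bd F H m c) = diff m (rebase m.+1 c).
Proof.
rewrite (delta_sum c) !linear_sum; apply: eq_bigr => B _; rewrite !linearZ /=; congr (_ *: _).
rewrite -/(basis_vec F B) bd_basis bd_cellE rebase_basis linear_sum linearZ /=.
(* Face [i] of [B] matches face [i - block B b] of the rotated cell, so the sum is reindexed by a
   cyclic shift. *)
rewrite /diff oper_gen ?pos_onto // [in RHS](reindex_inj (addIr (- block B b))) scaler_sumr.
apply: eq_bigr => i _; rewrite linearZ /= rebase_basis !scalerA -!exprD.
rewrite -[((i + _) %% _)%N]/(nat_of_ord (i - block B b)) ord_sub_crot crot_sign // block_face.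
congr (_ *: gen _ _); apply/ffunP => u.
by rewrite !ffunE !block_face crot_face_idx.
Qed.

Lemma lker_rebase m : lker (rebase m) = 0%VS.
Proof.
apply/eqP; rewrite -subv0; apply/subvP => c; rewrite memv_ker memv0 extendE => /eqP c0.
apply/eqP/ffunP => B; have := congr1 (fun d : chains => d (code (pos B))) c0.
rewrite /= sum_ffunE (bigD1 B) //= big1 => [|C CB].
  rewrite addr0 scalerA /gen pos_onto scale_deltaE eqxx [RHS]ffunE => /eqP.
  by rewrite mulf_eq0 signr_eq0 orbF => /eqP->; rewrite !ffunE.
rewrite scalerA /gen pos_onto scale_deltaE; case: eqP => // /(congr1 decode).
by rewrite !(@codeK m) ?pos_onto // => /pos_inj BC; rewrite BC eqxx in CB.
Qed.

Lemma limg_rebase m : (rebase m @: fullv)%VS = cell_space some_zero m.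
Proof.
apply/eqP; rewrite eqEsubv; apply/andP; split; apply/subvP.
  move=> _ /memv_imgP[c _ ->]; rewrite extendE; apply: rpred_sum => B _.
  rewrite !rpredZ // /gen pos_onto delta_coord_space //=.
  by rewrite !(@codeK m) ?pos_onto // pos_zero.
move=> c /coord_spaceE->; apply: rpred_sum => w /= /andP[wo wz]; apply: rpredZ.
have [B wE] := pos_surj wo wz.
have -> : delta w = rebase m ((-1) ^+ (m * block B b) *: basis_vec F B).
  by rewrite linearZ /= rebase_basis scalerA -expr2 sqrr_sign scale1r wE gen_decode.
exact: memv_img (memvf _).
Qed.

(** [rebase] is an injective chain map with image [cell_space some_zero], so cycles match cycles and
    boundaries match boundaries. *)
Lemma dim_HC m : \dim (HC F H m) = betti diff (cell_space some_zero) m.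
Proof.
have dimE (X : {vspace chain F H m}) : \dim (rebase m @: X) = \dim X.
  by apply: limg_dim_eq; rewrite lker_rebase capv0.
have inj l (x : chain F H l) : (rebase l x == 0) = (x == 0).
  by rewrite -memv_ker lker_rebase memv0.
have ZE : (rebase m @: cycles F H m)%VS = cyc (diff) (cell_space some_zero) m.
  case: m {dimE} => [|m] /=; first exact: limg_rebase.
  rewrite -limg_rebase; apply/vspaceP => x; rewrite memv_cap memv_ker.
  apply/memv_imgP/andP => [[c cZ ->]|[/memv_imgP[c _ ->]]].
    move: cZ; rewrite memv_ker => /eqP cZ.
    by rewrite memv_img ?memvf // -rebase_bd cZ linear0.
  by rewrite -rebase_bd inj -memv_ker => cZ; exists c.
have BE : (rebase m @: boundaries F H m)%VS = bnd (diff) (cell_space some_zero) m.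
  rewrite /boundaries /bnd -limg_rebase -!limg_comp; congr (_ @: _)%VS.
  by apply/lfunP => c; rewrite !comp_lfunE rebase_bd.
rewrite /betti -ZE -BE !dimE -(dimv_cap_compl (cycles F H m) (boundaries F H m)).
by rewrite (capv_idPr (boundaries_sub_cycles F H m)) addKn.
Qed.

Lemma diff_diff m x : x \in cell_space some_zero m.+2 -> diff m (diff m.+1 x) = 0.
Proof.
by rewrite -limg_rebase => /memv_imgP[c _ ->]; rewrite -!rebase_bd bd_bd linear0.
Qed.

End Rebase.

(** * Subcomplexes cut out by a condition on placements *)

Lemma eq_cell_space Z Z' m : Z =1 Z' -> cell_space Z m = cell_space Z' m.
Proof. by move=> ZZ'; apply: eq_coord_space => w /=; rewrite ZZ'. Qed.

Lemma gen_cell_space Z m f : Z f -> gen m f \in cell_space Z m.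
Proof.
move=> Zf; rewrite /gen; case: ifP => fo; last exact: rpred0.
by apply: delta_coord_space; rewrite /= (codeK fo) fo.
Qed.

Lemma cell_space_img Z m (W : vectType F) (phi : 'Hom(chains, W)) (X : {vspace W}) :
  (forall f, onto m f -> Z f -> phi (gen m f) \in X) ->
  {in cell_space Z m, forall c, phi c \in X}.
Proof.
by move=> phiX; apply: coord_space_img => w /andP[wo wZ]; rewrite -(gen_decode wo) phiX.
Qed.

Lemma cell_space_ind Z m (W : vectType F) (phi psi : 'Hom(chains, W)) :
  (forall f, onto m f -> Z f -> phi (gen m f) = psi (gen m f)) ->
  {in cell_space Z m, phi =1 psi}.
Proof.
by move=> E; apply: coord_space_ind => w /andP[wo wZ]; rewrite -(gen_decode wo) E.
Qed.

(** All placements vanish at [b], so each [cell_space Z] lies in the complex of the hypergraph with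
    single edge [[set b]], where [diff_diff] applies. *)
Lemma cell_space_diff_diff Z : square_zero diff (cell_space Z).
Proof.
move=> m x xZ; apply: (@diff_diff [set [set b]]) => [e|].
  by move/set1P->; exact: set11.
apply: (subvP (coord_spaceS _ _)) xZ => w /andP[/= wo _]; rewrite wo /=.
apply/existsP; exists [set b]; rewrite set11; apply/forall_inP => u /set1P->.
by case/ontoP: wo => ->.
Qed.

Lemma stable_cell_space Z :
  (forall m i f, Z f -> Z (glue m i f)) -> stable diff (cell_space Z).
Proof.
move=> Zglue m; apply: cell_space_img => f fo fZ; rewrite /diff oper_gen //.
by apply: rpred_sum => i _; rewrite rpredZ // gen_cell_space ?Zglue.
Qed.

Lemma zero_on_glue e m i f : zero_on e f -> zero_on e (glue m i f).
Proof.
move/forall_inP=> fe; apply/forall_inP => u /fe/eqP fu.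
by rewrite ffunE fu face_idx0.
Qed.

(** * Splitting a subtorus at a vertex *)

Section Vertex.
Variables (v : 'I_n) (e : {set 'I_n}).
Hypotheses (be : b \in e) (ve : v \notin e).

Let vb : v != b. Proof. by apply: contraNneq ve => ->. Qed.

Local Notation T := (cell_space (zero_on e)).
Local Notation U := (cell_space (zero_on (v |: e))).

(* With the other vertices fixed, [v] runs around a circle.  [unwind] is the arc
   from [b] to [v], [loop] the full turn, and [unloop] detects the passage of
   [v] through the last arc, just before [b]. *)
Definition collapse m : 'End(chains) := oper (fun f => gen m (put v 0 f)).

Definition unwind m : 'End(chains) := oper (fun f => - sweep v m (f v) f).

Definition loop m : 'End(chains) := oper (fun f => (-1) ^+ m *: sweep v m m.+1 f).

Definition unloop m : 'End(chains) :=
  oper (fun f => if f v == m.+1 then gen m (glue m m.+1 f) else 0).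

Lemma collapse_gen m f : onto m f -> collapse m (gen m f) = gen m (put v 0 f).
Proof. exact: oper_gen. Qed.

Lemma unwind_gen m f : onto m f -> unwind m (gen m f) = - sweep v m (f v) f.
Proof. exact: oper_gen. Qed.

Lemma loop_gen m f : onto m f -> loop m (gen m f) = (-1) ^+ m *: sweep v m m.+1 f.
Proof. exact: oper_gen. Qed.

Lemma unloop_gen m f : onto m.+1 f ->
  unloop m (gen m.+1 f) = if f v == m.+1 then gen m (glue m m.+1 f) else 0.
Proof. exact: oper_gen. Qed.

(** The complement of [U] in [T] given by the projection [collapse]; up to homotopy it is the
    suspension of [U]. *)
Definition fiber m : {vspace chains} := (T m :&: lker (collapse m))%VS.

Lemma memv_fiber m x : (x \in fiber m) = (x \in T m) && (collapse m x == 0).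
Proof. by rewrite memv_cap [X in _ && X]memv_ker. Qed.

Lemma zero_on_setU1 f : zero_on (v |: e) f = (f v == 0%N) && zero_on e f.
Proof.
apply/forall_inP/andP => [fe|[fv /forall_inP fe] u /setU1P[->|/fe]//].
  split; first by apply: fe; rewrite setU11.
  by apply/forall_inP => u ue; apply: fe; rewrite setU1r.
Qed.

Lemma zero_on_put f : zero_on e f -> zero_on (v |: e) (put v 0 f).
Proof.
move/forall_inP=> fe; apply/forall_inP => u; rewrite ffunE => /setU1P[->|/fe fu].
  by rewrite eqxx.
by case: (u =P v).
Qed.

Lemma put_id f : put v (f v) f = f.
Proof. by apply/ffunP => u; rewrite ffunE; case: eqP => // ->. Qed.

Lemma zero_on_ins l f : zero_on e f -> zero_on e (ins v l f).
Proof.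
move/forall_inP=> fe; apply/forall_inP => u ue; rewrite ffunE (negPf (memPn ve u ue)).
by rewrite (eqP (fe u ue)).
Qed.

Lemma sweep_T m i f : zero_on e f -> sweep v m i f \in T m.+1.
Proof.
by move=> fe; apply: rpred_sum => l _; rewrite rpredZ // gen_cell_space ?zero_on_ins.
Qed.

(** In each term [v] is alone in block [l.+1], which collapsing leaves empty. *)
Lemma collapse_sweep m i f : (i <= m.+1)%N -> collapse m.+1 (sweep v m i f) = 0.
Proof.
move=> im; rewrite linear_sum big1 // => l _; rewrite linearZ /= oper_gen_if.
case: ifP => _; rewrite ?scaler0 //.
rewrite (@missing_not_onto m.+1 _ l.+1) ?scaler0 //; first by have := ltn_ord l; lia.
by move=> u; rewrite !ffunE /bump; case: (u == v) => /=; lia.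
Qed.

Lemma fiber_sweep m i f : (i <= m.+1)%N -> zero_on e f -> sweep v m i f \in fiber m.+1.
Proof. by move=> im fe; rewrite memv_fiber sweep_T // collapse_sweep ?eqxx. Qed.

Lemma collapse_diff m : {in T m.+1, forall x, collapse m (diff m x) = diff m (collapse m.+1 x)}.
Proof.
move=> x xT; rewrite -!comp_lfunE; apply: cell_space_ind x xT => f fo fe.
have [fb fm _] := ontoP _ _ fo.
(* [put v 0 f] may be degenerate, hence [diff_gen] on the right as well. *)
rewrite !comp_lfunE (diff_gen fb fm) (collapse_gen fo) diff_gen ?linear_sum /=; last first.
- by move=> u; rewrite ffunE; case: eqP.
- by rewrite ffunE eq_sym (negPf vb).
apply: eq_bigr => i _; rewrite linearZ /= oper_gen ?onto_glue //.
congr (_ *: gen _ _); apply/ffunP => u; rewrite !ffunE.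
by case: eqP; rewrite ?face_idx0.
Qed.

Lemma collapse_U m : {in U m, forall x, collapse m x = x}.
Proof.
move=> x xU; rewrite -[RHS](id_lfunE x); apply: cell_space_ind x xU => f fo.
rewrite zero_on_setU1 => /andP[/eqP fv _]; rewrite id_lfunE oper_gen //.
by rewrite -{2}(put_id f) fv.
Qed.

Lemma collapse_img m : {in T m, forall x, collapse m x \in U m}.
Proof.
apply: cell_space_img => f fo fe; rewrite oper_gen //.
by rewrite gen_cell_space ?zero_on_put.
Qed.

Lemma U_sub_T m : (U m <= T m)%VS.
Proof.
by apply: coord_spaceS => w /andP[/= ->]; rewrite zero_on_setU1 => /andP[].
Qed.

Lemma U_add_fiber m : (U m + fiber m)%VS = T m.
Proof.
apply/eqP; rewrite eqEsubv subv_add U_sub_T capvSl /=; apply/subvP => x xT.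
rewrite -(subrK (collapse m x) x) addrC memv_add ?collapse_img //.
rewrite memv_fiber linearB /= (collapse_U (collapse_img xT)) subrr eqxx andbT.
by rewrite rpredB // (subvP (U_sub_T m)) // collapse_img.
Qed.

Lemma U_cap_fiber m : (U m :&: fiber m)%VS = 0%VS.
Proof.
apply/eqP; rewrite -subv0; apply/subvP => x; rewrite memv_cap memv_fiber memv0.
by case/and3P => /collapse_U->.
Qed.

Lemma stable_T : stable diff T.
Proof. by apply: stable_cell_space => m i f; apply: zero_on_glue. Qed.

Lemma stable_U : stable diff U.
Proof. by apply: stable_cell_space => m i f; apply: zero_on_glue. Qed.

Lemma stable_fiber : stable diff fiber.
Proof.
move=> m x; rewrite !memv_fiber => /andP[xT /eqP cx].
by rewrite stable_T // collapse_diff // cx linear0 eqxx.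
Qed.

Lemma square_zero_fiber : square_zero diff fiber.
Proof. by move=> m x; rewrite memv_fiber => /andP[xT _]; apply: cell_space_diff_diff xT. Qed.

Lemma unwind_fiber m : {in fiber m, forall x, unwind m x \in fiber m.+1}.
Proof.
move=> x; rewrite memv_fiber => /andP[xT _]; apply: cell_space_img x xT => f fo fe.
rewrite oper_gen // rpredN fiber_sweep //.
by case/ontoP: fo => _ fm _; rewrite ltnW ?ltnS.
Qed.

Lemma loop_fiber m : {in U m, forall x, loop m x \in fiber m.+1}.
Proof.
apply: cell_space_img => f fo; rewrite zero_on_setU1 => /andP[_ fe].
by rewrite oper_gen // rpredZ // fiber_sweep.
Qed.

Lemma unloop_U m : {in fiber m.+1, forall x, unloop m x \in U m}.
Proof.
move=> x; rewrite memv_fiber => /andP[xT _]; apply: cell_space_img x xT => f fo fe.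
rewrite oper_gen //; case: eqP => fv; last exact: rpred0.
rewrite gen_cell_space // zero_on_setU1 zero_on_glue // andbT ffunE fv.
by case: (face_idxE m m.+1 m.+1) => -[] *; lia.
Qed.

Lemma diff_loop0 : {in U 0, forall x, diff 0 (loop 0 x) = 0}.
Proof.
move=> x xU; rewrite -comp_lfunE -[RHS](zero_lfunE _ x).
apply: cell_space_ind x xU => f fo fe.
rewrite zero_lfunE comp_lfunE loop_gen // linearZ /= /sweep big_ord1 !expr0 !scale1r.
case: (boolP (onto 1 (ins v 0 f))) => [/diff0_gen->//|fo'].
by rewrite /gen (negPf fo') linear0.
Qed.

(** A full turn ends where it starts, so its endpoints cancel and only sweeps of faces remain; the
    sign in [loop] absorbs the minus in front of them. *)
Lemma diff_loopS m : {in U m.+1, forall x, diff m.+1 (loop m.+1 x) = loop m (diff m x)}.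
Proof.
move=> x xU; rewrite -!comp_lfunE; apply: cell_space_ind x xU => f fo fe.
have [fb fm _] := ontoP _ _ fo.
rewrite !comp_lfunE loop_gen // linearZ /= (diff_sweep vb fb fm) // modnn subrr sub0r.
rewrite diff_gen // [in RHS]linear_sum /= exprS mulN1r scaleNr scalerN opprK scaler_sumr.
apply: eq_bigr => j _; rewrite [in RHS]linearZ /= loop_gen ?onto_glue // ltn_ord subn1.
by rewrite !scalerA mulrC.
Qed.

(** Only the last term of the sweep has [v] in the last block; the wrap then returns [v] to block 0,
    giving back [f]. *)
Lemma unloop_loop m : {in U m, forall x, unloop m (loop m x) = x}.
Proof.
move=> x xU; rewrite -comp_lfunE -[RHS](id_lfunE x).
apply: cell_space_ind x xU => f fo fe; have [fb fm fs] := ontoP _ _ fo.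
rewrite id_lfunE comp_lfunE oper_gen // linearZ linear_sum /= big_ord_recr /= big1 => [|l _].
  move: fe; rewrite zero_on_setU1 => /andP[/eqP fv _].
  (* No block is emptied: [v] leaves block 0, which keeps [b]. *)
  have io : onto m.+1 (ins v m f).
    apply/ontoP; split; [exact: ins_b | exact: ins_le (leqnn m) fm | move=> j].
    rewrite leq_eqVlt => /predU1P[->|jm].
      by exists v; rewrite ffunE eqxx.
    case: (posnP j) => [->|j0]; first by exists b; apply: ins_b.
    have [u fu] := fs j jm; exists u; rewrite ffunE.
    case: eqP => [uv|_]; first by move: fu j0; rewrite uv fv; lia.
    by rewrite fu /bump ltnNge -ltnS jm.
  rewrite add0r linearZ /= oper_gen // ffunE eqxx eqxx scalerA -expr2 sqrr_sign scale1r.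
  congr gen; apply/ffunP => u; rewrite !ffunE /bump ltnNge fm add0n; have := fm u.
  by case: (u =P v) => [->|_]; rewrite ?fv => ?; face_idx_cases.
rewrite linearZ /= oper_gen_if ffunE eqxx.
by case: ifP; rewrite ?scaler0 // eqSS ltn_eqF ?scaler0.
Qed.

Lemma fiber_homotopy m : {in fiber m.+1, forall x,
  x - loop m (unloop m x) = diff m.+1 (unwind m.+1 x) + unwind m (diff m x)}.
Proof.
move=> x; rewrite memv_fiber => /andP[xT /eqP cx].
(* The generators of [T] need not lie in the fiber, so the identity is checked on all of [T], with
   [collapse] as a correction that vanishes on the fiber. *)
suff E : {in T m.+1, \1 - collapse m.+1 - (loop m \o unloop m) =1
    (diff m.+1 \o unwind m.+1) + (unwind m \o diff m)}%VF.
  by move: (E x xT); rewrite !(add_lfunE, opp_lfunE, comp_lfunE, id_lfunE) cx subr0.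
apply: cell_space_ind => f fo fe; have [fb fm fs] := ontoP _ _ fo.
rewrite !(add_lfunE, opp_lfunE, comp_lfunE, id_lfunE) (unwind_gen fo) (collapse_gen fo).
rewrite (unloop_gen fo) linearN /= (diff_sweep vb fb fm) ?(leq_trans (fm v)) //.
rewrite modn_small ?ltnS // put_id !opprB [X in _ = X + _]addrC -[RHS]addrA; congr (_ + _).
(* All faces but the wrap cancel. The wrap contributes only when [v] is in the last block: it sends
   [v] to 0, and the uncancelled sweep is a full turn. *)
rewrite (diff_gen fb fm) linear_sum /= -big_split /= big_ord_recr big1 /= => [|j _].
  rewrite linearZ /= unwind_gen ?onto_glue // ffunE ltnNge fm subn0 add0r.
  case: eqP => fv.
    rewrite loop_gen ?onto_glue // fv.
    have -> : face_idx m m.+1 m.+1 = 0%N by face_idx_cases.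
    by rewrite /sweep big_ord0 oppr0 scaler0 addr0 exprS mulN1r scaleNr.
  have -> : face_idx m m.+1 (f v) = f v by face_idx_cases.
  by rewrite linear0 oppr0 scalerN subrr.
rewrite linearZ /= unwind_gen ?onto_glue // ffunE.
have -> : face_idx m j (f v) = (f v - (j < f v))%N by have := ltn_ord j; face_idx_cases.
by rewrite scalerN subrr.
Qed.

Lemma betti_fiberS m : betti diff fiber m.+1 = betti diff U m.
Proof.
apply: (@betti_suspension _ _ _ U fiber loop unloop unwind).
- exact: cell_space_diff_diff.
- exact: stable_U.
- exact: square_zero_fiber.
- exact: stable_fiber.
- exact: loop_fiber.
- exact: unloop_U.
- exact: unwind_fiber.
- exact: diff_loop0.
- exact: diff_loopS.
- exact: unloop_loop.
exact: fiber_homotopy.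
Qed.

(** With a single block [v] is already at 0, so [collapse] is the identity and its kernel is 0. *)
Lemma betti_fiber0 : betti diff fiber 0 = 0%N.
Proof.
rewrite /betti /cyc (_ : fiber 0 = 0%VS) ?dimv0 //; apply/eqP; rewrite -subv0.
apply/subvP => x; rewrite memv_fiber memv0 => /andP[xT /eqP cx].
suff E : {in T 0, \1%VF =1 collapse 0} by rewrite -cx -E // id_lfunE.
apply: cell_space_ind => f fo fe; rewrite id_lfunE collapse_gen //.
case/ontoP: fo => _ fm _; rewrite -{1}(put_id f).
by have -> : f v = 0%N by apply/eqP; rewrite -leqn0.
Qed.

Lemma betti_vertex m : betti diff T m = (betti diff U m + betti diff fiber m)%N.
Proof.
apply: betti_direct.
- exact: cell_space_diff_diff.
- exact: stable_U.
- exact: stable_fiber.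
- exact: U_add_fiber.
exact: U_cap_fiber.
Qed.

End Vertex.

(** * Betti numbers of subtori and of their unions *)

Lemma betti_zero_onT m : betti diff (cell_space (zero_on [set: 'I_n])) m = (m == 0%N).
Proof.
(* The only cell has all vertices in one block. *)
have cell0 w l : onto l (decode w) && zero_on [set: 'I_n] (decode w) =
    (l == 0%N) && (w == code [ffun=> 0%N]).
  apply/andP/andP => [[/ontoP[_ _ /(_ l (leqnn _))[u ul]] /forall_inP w0]|[/eqP-> /eqP->]].
    have l0 : l = 0%N by rewrite -ul; apply/eqP; apply: w0; rewrite inE.
    split; rewrite ?l0 //; apply/eqP; rewrite -(decodeK w); congr code; apply/ffunP => y.
    by rewrite [RHS]ffunE; apply/eqP; apply: w0; rewrite inE.
  have o : onto 0 [ffun=> 0%N].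
    apply/ontoP; split=> [|u|j]; rewrite ?ffunE // leqn0 => /eqP->.
    by exists b; rewrite ffunE.
  by rewrite (codeK o); split=> //; apply/forall_inP => u _; rewrite ffunE.
have S0 l : cell_space (zero_on [set: 'I_n]) l.+1 = 0%VS.
  apply/eqP; rewrite -subv0; apply/subvP => x /coord_spaceE->; rewrite big_pred0 ?mem0v //.
  by move=> w; rewrite /= cell0.
rewrite /betti /bnd S0 limg0 dimv0 subn0; case: m => [|m] /=; last by rewrite S0 cap0v dimv0.
rewrite (_ : cell_space _ 0 = <[delta (code [ffun=> 0%N])]>%VS).
  rewrite dim_vline; case: eqP => // /ffunP/(_ (code [ffun=> 0%N])).
  by rewrite !ffunE eqxx => /eqP; rewrite oner_eq0.
apply/eqP; rewrite eqEsubv; apply/andP; split.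
  apply/subvP => x /coord_spaceE->; apply: rpred_sum => w; rewrite /= cell0 /= => /eqP->.
  by rewrite rpredZ // memv_line.
by apply/subvP => x /vlineP[a ->]; apply: rpredZ; apply: delta_coord_space; rewrite /= cell0 !eqxx.
Qed.

(** Induction on the number of vertices outside [e]: [v |: e] and its suspension contribute the two
    terms of Pascal's rule. *)
Lemma betti_zero_on (e : {set 'I_n}) m : b \in e ->
  betti diff (cell_space (zero_on e)) m = 'C(n - #|e|, m).
Proof.
have [d] := ubnP (n - #|e|); elim: d e m => // d IHd e m led be.
have [/eqP eT|] := boolP (e == setT).
  by rewrite eT betti_zero_onT cardsT card_ord subnn; case: m.
rewrite eqEsubset subsetT /= => /subsetPn[v _ ve].
have card_ve : (n - #|e| = (n - #|v |: e|).+1)%N.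
  by have := max_card (mem (v |: e)); rewrite cardsU1 ve card_ord; lia.
have IH l : betti diff (cell_space (zero_on (v |: e))) l = 'C(n - #|v |: e|, l).
  by apply: IHd; [lia | rewrite setU1r].
rewrite (betti_vertex be ve) IH card_ve; case: m => [|m].
  by rewrite betti_fiber0 !bin0 addn0.
by rewrite (betti_fiberS be ve) IH binS addnC.
Qed.

(* The hypotheses on [Z] say that the subcomplex [Z] meets the subtorus of [e]
   in the subtorus of [v |: e]. *)
Lemma betti_attach v (e : {set 'I_n}) Z m :
    b \in e -> v \notin e ->
    (forall m i f, Z f -> Z (glue m i f)) ->
    (forall f, zero_on (v |: e) f -> Z f) ->
    (forall f, Z f -> zero_on e f -> zero_on (v |: e) f) ->
  (betti diff (cell_space [pred f | Z f || zero_on e f]) m + 'C(n - #|e|.+1, m) =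
   betti diff (cell_space Z) m + 'C(n - #|e|, m))%N.
Proof.
move=> be ve Zglue Zve Ze.
(* The union is the direct sum of [Z] and the fiber: [T_e] is [U] plus the fiber, [U] lies in [Z],
   and [Z] meets [T_e] inside [U]. *)
rewrite (@betti_direct _ _ _ _ (cell_space Z) (fiber v e)); first last.
- move=> l; apply/eqP; rewrite -subv0; apply/subvP => x; rewrite memv_cap => /andP[xZ xf].
  rewrite -(@U_cap_fiber v e l) memv_cap xf andbT.
  have xT : x \in cell_space (zero_on e) l by move: xf; rewrite memv_fiber => /andP[].
  have : x \in (cell_space Z l :&: cell_space (zero_on e) l)%VS by rewrite memv_cap xZ.
  rewrite coord_space_cap; apply: subvP; apply: coord_spaceS => w /=.
  by case/andP => /andP[-> wZ] /andP[_ wT]; apply: Ze.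
- move=> l; apply/eqP; rewrite eqEsubv subv_add; apply/andP; split.
    apply/andP; split; first by apply: coord_spaceS => w /= /andP[-> ->].
    apply/subvP => x; rewrite memv_fiber => /andP[xT _]; move: xT.
    by apply: subvP; apply: coord_spaceS => w /= /andP[-> ->]; rewrite orbT.
  have -> : cell_space [pred f | Z f || zero_on e f] l =
      (cell_space Z l + cell_space (zero_on e) l)%VS.
    by rewrite coord_space_add; apply: eq_coord_space => w /=; rewrite andb_orr.
  rewrite subv_add addvSl -(@U_add_fiber v e l) addvS //.
  by apply: coord_spaceS => w /= /andP[-> /Zve].
- exact: stable_fiber.
- exact: stable_cell_space.
- exact: cell_space_diff_diff.
rewrite -addnA; congr (_ + _)%N; rewrite addnC.
rewrite -(betti_zero_on m be) (betti_vertex be ve) betti_zero_on ?setU1r //.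
by rewrite cardsU1 ve.
Qed.

End Model.

(* Attaching the edges of a diagonal hypergraph one by one *)
Local Close Scope ring_scope.

Theorem theorem5p3 (F : fieldType) (charF0 : [pchar F]%R =i pred0)
    (n k : nat) (H : {set {set 'I_n}}) (Hdiag : diagonal H k)
    (Hk : uphalf n < k) :
  (forall r : nat, r < n - k ->
     \dim (HC F H r.+1) = (n - k) * 'C(n - k - 1, r) + 'C(n - k, r.+1))
  /\ \dim (HC F H 0) = 1.
Proof.
case/and4P: Hdiag => kn /forall_inP unifH _ /existsP[s /eqP HE].
have nk : (n - k < k)%N by lia.
pose I j : {set 'I_n} := [set u : 'I_n | (j <= u < j + k)%N].
have ltn u : (u <= n - k)%N -> (u < n)%N by lia.
(* The ordinal [n - k] lies in every interval [I j] with [j <= n - k], since [n - k < k]. *)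
pose b := s (Ordinal (ltn _ (leqnn (n - k)))).
have EH j : (j <= n - k)%N -> s @: I j \in H.
  move=> jn; rewrite HE; apply: imset_f; apply/imsetP.
  by exists (Ordinal (jn : (j < (n - k).+1)%N)).
have HEx e : e \in H -> exists2 j, (j <= n - k)%N & e = s @: I j.
  by rewrite HE => /imsetP[_ /imsetP[j _ ->] ->]; exists (val j) => //; apply: leq_ord.
have bE j : (j <= n - k)%N -> b \in s @: I j.
  by move=> jn; apply: imset_f; rewrite inE /=; lia.
have Hb e : e \in H -> b \in e by case/HEx => j jn ->; apply: bE.
have cardE j : (j <= n - k)%N -> #|s @: I j| = k by move/EH/unifH/eqP.
pose X i (f : {ffun 'I_n -> nat}) := [exists j : 'I_i.+1, zero_on (s @: I j) f].
(* The first subtorus gives ['C(n - k, m)], and each of the [i] attachments adds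
   ['C(n - k, m) - 'C((n - k).-1, m)]; the equation is kept free of subtraction. *)
have bettiX i m : (i <= n - k)%N ->
    (betti (diff F b) (cell_space F b (X i)) m + i * 'C((n - k).-1, m) =
     i.+1 * 'C(n - k, m))%N.
  elim: i => [|i IHi] im.
    rewrite addn0 mul1n -[in RHS](cardE 0%N im) -(betti_zero_on F m (bE 0%N im)).
    apply: eq_betti => l; apply: eq_cell_space => f.
    by apply/existsP/idP => [[j]|f0]; [rewrite (ord1 j) | exists ord0].
  have iv : (i < n)%N by lia.
  (* The one vertex of edge [i] that is missing from edge [i.+1]. *)
  pose v := s (Ordinal iv).
  have vE j : (v \in s @: I j) = (j <= i < j + k)%N by rewrite mem_imset ?inE //; apply: perm_inj.
  have step := @betti_attach F n b v (s @: I i.+1) (X i) m (bE _ im).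
  have := IHi (ltnW im).
  have -> : betti (diff F b) (cell_space F b (X i.+1)) m =
      betti (diff F b) (cell_space F b [pred f | X i f || zero_on (s @: I i.+1) f]) m.
    apply: eq_betti => l; apply: eq_cell_space => f /=.
    apply/existsP/orP => [[j fj]|[/existsP[j fj]|fi]].
    - have [ji|ij] := ltnP j i.+1; first by left; apply/existsP; exists (Ordinal ji).
      right; rewrite (_ : i.+1 = j :> nat) //; apply/eqP; rewrite eqn_leq ij /=.
      exact: leq_ord.
    - by exists (widen_ord (leqnSn _) j).
    by exists ord_max.
  move: step; rewrite cardE // => step IH.
  have {}step : (betti (diff F b) (cell_space F b [pred f | X i f || zero_on (s @: I i.+1) f]) m
      + 'C((n - k).-1, m) = betti (diff F b) (cell_space F b (X i)) m + 'C(n - k, m))%N.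
    rewrite subnS in step; apply: step.
    - by rewrite vE; lia.
    - move=> m' j f /existsP[l fl]; apply/existsP; exists l; exact: zero_on_glue.
    - move=> f; rewrite zero_on_setU1 => /andP[fv /forall_inP fi]; apply/existsP; exists ord_max.
      apply/forall_inP => _ /imsetP[u uI ->].
      have [->|ui] := eqVneq u (Ordinal iv); first exact: fv.
      apply: fi; apply: imset_f; move: uI ui; rewrite !inE -val_eqE /=; lia.
    (* Every earlier edge contains [v], because [j <= i < k]. *)
    move=> f /existsP[j /forall_inP fj] fi; rewrite zero_on_setU1 fi andbT; apply: fj.
    by rewrite vE; have := ltn_ord j; lia.
  nia.
have dimE m : (\dim (HC F H m) + (n - k) * 'C((n - k).-1, m) = (n - k).+1 * 'C(n - k, m))%N.
  rewrite (dim_HC F Hb) -bettiX //; congr (_ + _)%N.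
  apply: eq_betti => l; apply: eq_cell_space => f.
  apply/existsP/existsP => [[e /andP[/HEx[j jn ->] fe]]|[j fj]].
    by exists (Ordinal (jn : (j < (n - k).+1)%N)).
  by exists (s @: I j); rewrite EH ?leq_ord.
split=> [r rn|].
  (* Here [N.+1] is [n - k], while [p] and [q] are ['C(N, r.+1)] and ['C(N, r)], with sum
     ['C(N.+1, r.+1)]. *)
  have aux (x p q N : nat) : (x + N.+1 * p = N.+2 * (p + q) -> x = N.+1 * q + (p + q))%N.
    by nia.
  have := dimE r.+1; rewrite subn1; case: (n - k)%N rn => // N _ /=.
  by rewrite binS; apply: aux.
by have := dimE 0%N; rewrite !bin0; lia.
Qed.
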